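(* Let $L\ge 2$ be an integer and $h>0$ a real number. Let $F(s)$ be a stable, real-rational, strictly proper (single-input single-output) transfer function, let $\mu\ge 1$, let $G_1(s),\dots,G_\mu(s)$ be stable, real-rational, proper (single-input single-output) transfer functions, and let $m_1,\dots,m_\mu$ be non-negative integers. Put $$K_{\rm c}(s)=\sum_{i=1}^{\mu} e^{-m_i h s}G_i(s).$$ For each $i\in\{1,\dots,\mu\}$ let $K_i(z)=\sum_{k=0}^{M-1}a^{(i)}_k z^{-k}$, with $a^{(i)}_k\in\mathbb{R}$, be the $H^\infty$-optimal FIR digital filter of length $M$ for the target $e^{-m_i h s}G_i(s)$ with delay step $0$, in the sense (optimality with respect to the fast sample/hold approximation) defined in the context, and let $$\gamma_i=\left\|\left(e^{-m_i h s}G_i-\mathcal{H}_{h/L}K_i(\uparrow\! L)\mathcal{S}_h\right)F\right\|_\infty .$$ Let $\bar K(z)=\sum_{i=1}^{\mu}K_i(z)$. Then $$\left\|\left(K_{\rm c}-\mathcal{H}_{h/L}\bar K(\uparrow\! L)\mathcal{S}_h\right)F\right\|_\infty\le\sum_{i=1}^{\mu}\gamma_i .$$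
   Context: **Signals and operators.** $L^2=L^2[0,\infty)$ is the space of square integrable real functions on $[0,\infty)$ with norm $\|f\|_2=\left(\int_0^\infty|f(t)|^2dt\right)^{1/2}$. A transfer function is identified with the linear input/output operator it defines (with zero initial state). $e^{-ls}$ is the delay operator $(e^{-ls}y)(t)=y(t-l)$, with signals taken to be zero for negative time. - For $\tau>0$, $\mathcal{S}_\tau$ is the ideal sampler, $(\mathcal{S}_\tau u)[n]=u(n\tau)$, $n=0,1,2,\dots$. - For $\tau>0$, $\mathcal{H}_\tau$ is the zero-order hold, $(\mathcal{H}_\tau\psi)(t)=\psi[n]$ for $t\in[n\tau,(n+1)\tau)$, $n=0,1,2,\dots$. - For a positive integer $L$, the upsampler $\uparrow\! L$ maps $\{x[0],x[1],\dots\}$ to $\{x[0],0,\dots,0,x[1],0,\dots,0,x[2],\dots\}$, with $L-1$ zeros inserted after each sample. **Norm of the sampled-data error system.** For an operator $\mathcal{E}$ acting on $L^2$ (such as the two error systems in the claim), $\|\mathcal{E}\|_\infty=\sup_{w\in L^2,\,w\ne0}\|\mathcal{E}w\|_2/\|w\|_2$. **$H^\infty$ norm of a discrete-time system.** For a stable discrete-time transfer matrix $G(z)$, $\|G\|_\infty=\max_{\theta\in[0,\pi]}\sigma_{\max}(G(e^{j\theta}))$, where $\sigma_{\max}$ is the largest singular value. **Lifting.** For a positive integer $N$, let $\mathbf{L}_N$ be the blocking operator sending a scalar sequence $\{x[k]\}$ to the $\mathbb{R}^N$-valued sequence whose $k$-th term is $(x[kN],x[kN+1],\dots,x[kN+N-1])^\top$.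 For a discrete-time linear time-invariant system $P$, $\mathbf{lift}(P,N)=\mathbf{L}_N P\,\mathbf{L}_N^{-1}$, an $N\times N$ discrete-time LTI system. **$H^\infty$-optimal FIR digital filter (delay step $0$).** Fix the FIR length $M\ge1$ and the fast sample/hold factor $N=Lp$ for a positive integer $p$. For a stable target system $K_{\rm t}(s)$ (here $K_{\rm t}(s)=e^{-m_ihs}G_i(s)$) and an FIR filter $K(z)=\sum_{k=0}^{M-1}a_kz^{-k}$, the fast sample/hold approximation of the error system $\left(K_{\rm t}-\mathcal{H}_{h/L}K(\uparrow\! L)\mathcal{S}_h\right)F$ is $$E_{{\rm mr},N}(z)=\left(K_N(z)-\widetilde H_N\widetilde K(z)S_N\right)F_N(z),$$ where - $K_N=\mathbf{lift}(\mathcal{S}_{h/N}K_{\rm t}\mathcal{H}_{h/N},N)$ and $F_N=\mathbf{lift}(\mathcal{S}_{h/N}F\mathcal{H}_{h/N},N)$; - $S_N=[1,0,\dots,0]\in\mathbb{R}^{1\times N}$; - $\widetilde K(z)=\mathbf{lift}(K(z),L)\,[1,0,\dots,0]^\top$ (an $L\times1$ system); - $\widetilde H_N\in\mathbb{R}^{N\times L}$ is the block-diagonal matrix with $L$ diagonal blocks each equal to $[1,\dots,1]^\top\in\mathbb{R}^p$. The $H^\infty$-optimal FIR digital filter for $K_{\rm t}$ is the $K(z)$ whose coefficient vector $(a_0,\dots,a_{M-1})^\top\in\mathbb{R}^M$ minimizes $\|E_{{\rm mr},N}\|_\infty$ (by the KYP lemma this minimization is expressed as a linear matrix inequality optimization).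 *)

(* Defs.v *)
From HB Require Import structures.
From mathcomp Require Import all_boot all_order all_algebra.
From mathcomp Require Import all_classical all_reals all_analysis.
From mathcomp Require Import complex.
Set Implicit Arguments.
Unset Strict Implicit.
Unset Printing Implicit Defensive.
Import Order.TTheory GRing.Theory Num.Theory.
Import numFieldNormedType.Exports.
Local Open Scope classical_set_scope.
Local Open Scope complex_scope.
Local Open Scope sesquilinear_scope.
Local Open Scope ring_scope.

(* A continuous-time signal is a function [R -> R] of which only the values on
   [0, +oo[ matter: every operator below reads its argument at nonnegative
   times only, and the L2 norm ignores negative times. *)
Notation signal R := (R -> R) (only parsing).
Notation dsignal R := (nat -> R) (only parsing).

Section Signals.
Variable R : realType.
Implicit Types (w u y : signal R) (x : dsignal R).

Definition causal_part w : signal R := w \_ `[0, +oo[.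

Definition L2norm w : \bar R :=
  ('N[lebesgue_measure]_(2%:E)[EFin \o causal_part w])%E.

Definition in_L2 w : Prop := causal_part w \in Lfun lebesgue_measure 2%:E.

(* An element of L2 is nonzero when its norm is, functions equal almost
   everywhere being identified. *)
Definition sd_norm (E : signal R -> signal R) : \bar R :=
  ereal_sup [set (L2norm (E w) / L2norm w)%E
            | w in [set w | in_L2 w /\ L2norm w != 0%E]].

Definition delay (l : R) y : signal R :=
  fun t => if l <= t then y (t - l) else 0.

Definition sampler (tau : R) u : dsignal R := fun n => u (n%:R * tau).

(* For t >= 0, [Num.truncn (t / tau)] is the n with n tau <= t < (n + 1) tau. *)
Definition hold (tau : R) x : signal R := fun t => x (Num.truncn (t / tau)).

Definition upsample (L : nat) x : dsignal R :=
  fun n => if (L %| n)%N then x (n %/ L)%N else 0.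

Definition fir (M : nat) (a : 'cV[R]_M) x : dsignal R :=
  fun n => \sum_(k < M | (k <= n)%N) a k 0 * x (n - k)%N.

End Signals.

Record ratfun (R : realType) := RatFun {
  numer : {poly R};
  denom : {poly R};
  denom_neq0 : denom != 0;
  numer_denom_coprime : coprimep numer denom }.

Section Transfer.
Variable R : realType.
Implicit Types G : ratfun R.

Definition proper_tf G : Prop := (size (numer G) <= size (denom G))%N.

Definition strictly_proper_tf G : Prop := (size (numer G) < size (denom G))%N.

(* As numerator and denominator are coprime, the roots of [denom G] are the
   poles of [G]. *)
Definition stable_tf G : Prop :=
  forall z : R[i], root (map_poly (real_complex R) (denom G)) z ->
    complex.Re z < 0.

(* Coefficients of the expansion G(s) = \sum_k markov G k * s ^- k at
   infinity; [markovP] says that, for every k,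
   G(s) = \sum_(i <= k) markov G i * s ^- i + O(s ^- k.+1). *)
Definition markov G (k : nat) : R := (('X^k * numer G) %/ denom G)`_0.

Lemma markovP G k : proper_tf G ->
  ('X^k * numer G) %/ denom G = \sum_(i < k.+1) markov G i *: 'X^(k - i).
Proof.
move=> pG; have const (p : {poly R}) : (size p <= size (denom G))%N ->
    p %/ denom G = ((p %/ denom G)`_0)%:P.
  move=> sp; apply: size1_polyC; rewrite size_divp ?denom_neq0//.
  move: (denom_neq0 G); rewrite -size_poly_gt0.
  by case: (size (denom G)) sp => // n sp _; rewrite leq_subLR addn1.
elim: k => [|k IH].
  rewrite big_ord1 subnn expr0 alg_polyC /markov expr0 mul1r.
  exact: const.
have step : ('X^(k.+1) * numer G) %/ denom G =
    'X * (('X^k * numer G) %/ denom G) + (markov G k.+1)%:P.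
  set q := ('X^k * numer G) %/ denom G; set r := ('X^k * numer G) %% denom G.
  have sr : (size ('X * r)%R <= size (denom G))%N.
    have rd : (size r < size (denom G))%N by rewrite ltn_modp denom_neq0.
    have [->|r0] := eqVneq r 0; first by rewrite mulr0 size_poly0.
    by rewrite mulrC size_mulX.
  have E : ('X^(k.+1) * numer G) %/ denom G = 'X * q + ('X * r) %/ denom G.
    rewrite exprS -mulrA (divp_eq ('X^k * numer G) (denom G)) -/q -/r.
    by rewrite mulrDr mulrA divpD mulpK ?denom_neq0.
  by rewrite /markov E (const _ sr) coefD coefXM coefC/= add0r.
rewrite step IH [RHS]big_ord_recr/= subnn expr0 alg_polyC; congr (_ + _).
rewrite mulr_sumr; apply: eq_bigr => i _.
by rewrite subSn ?exprS -?scalerAr// -ltnS.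
Qed.

(* Inverse Laplace transform of G(s) - G(oo), taken termwise on the expansion
   above: s ^- k.+1 is the Laplace transform of t ^+ k / k`!. *)
Definition impulse_response G (t : R) : R :=
  limn (series (fun k => markov G k.+1 * t ^+ k / k`!%:R)).

(* The input/output operator of G with zero initial state: direct feedthrough
   G(oo) plus convolution with the impulse response. *)
Definition io (G : ratfun R) (u : signal R) : signal R := fun t =>
  markov G 0 * u t +
  \int[lebesgue_measure]_(s in `[0, t]) (impulse_response G (t - s) * u s).

End Transfer.

Section Discrete.
Variable R : realType.

Definition block (N : nat) (x : dsignal R) : dsignal 'cV[R]_N :=
  fun k => \col_(i < N) x (k * N + i)%N.

Definition unblock (N : nat) (y : dsignal 'cV[R]_N) : dsignal R :=
  fun n => if insub (n %% N)%N is Some j then y (n %/ N)%N j 0 else 0.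

Lemma blockK N : (0 < N)%N -> cancel (@block N) (@unblock N).
Proof.
move=> N0 x; apply/funext => n; rewrite /unblock insubT ?ltn_mod// => ltnN.
by rewrite mxE /= -divn_eq.
Qed.

Lemma unblockK N : (0 < N)%N -> cancel (@unblock N) (@block N).
Proof.
move=> N0 y; apply/funext => k; apply/matrixP => i j; rewrite mxE ord1.
rewrite /unblock divnMDl// divn_small// addn0 modnMDl modn_small//.
by rewrite valK.
Qed.

Definition lifted (P : dsignal R -> dsignal R) (N : nat) :
    dsignal 'cV[R]_N -> dsignal 'cV[R]_N :=
  fun y => block N (P (unblock y)).

(* k-th impulse response matrix: column j is the response at time k to the
   unit pulse at time 0 in input channel j. *)
Definition pulse_response m n (P : dsignal 'cV[R]_m -> dsignal 'cV[R]_n)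
    (k : nat) : 'M[R]_(n, m) :=
  \matrix_(i, j) P (fun l => if l == 0%N then delta_mx j 0 else 0) k i 0.

Definition tf m n (P : dsignal 'cV[R]_m -> dsignal 'cV[R]_n) (z : R[i]) :
    'M[R[i]]_(n, m) :=
  \matrix_(i, j) limn (series
    (fun k => (pulse_response P k i j)%:C * z ^- k : R[i]^o)).

Definition expj (theta : R) : R[i] := cos theta +i* sin theta.

(* The singular values of A are the nonnegative square roots of the
   eigenvalues of A^* A. *)
Definition sigma_max m n (A : 'M[R[i]]_(m, n)) : R :=
  sup [set s : R | 0 <= s /\ eigenvalue (A ^t* *m A) (s ^+ 2)%:C].

Definition hinf_norm m n (G : R[i] -> 'M[R[i]]_(m, n)) : \bar R :=
  ereal_sup [set (sigma_max (G (expj theta)))%:E | theta in `[0, pi]].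

End Discrete.

Arguments lifted {R} P N y _.

Section Design.
Variable R : realType.
Variables (h : R) (L : nat).

(* (Kt - H_{h/L} K (up L) S_h) F *)
Definition error_system (Kt : signal R -> signal R)
    (K : dsignal R -> dsignal R) (F : ratfun R) : signal R -> signal R :=
  fun w t => Kt (io F w) t -
    hold (h / L%:R) (K (upsample L (sampler h (io F w)))) t.

Definition fast_lifted (N : nat) (T : signal R -> signal R) :=
  lifted (fun x => sampler (h / N%:R) (T (hold (h / N%:R) x))) N.

Definition S_row (N : nat) : 'M[R[i]]_(1, N) :=
  \row_(j < N) (val j == 0%N)%:R.

Definition Ktilde (K : dsignal R -> dsignal R) (z : R[i]) : 'M[R[i]]_(L, 1) :=
  tf (lifted K L) z *m \col_(i < L) (val i == 0%N)%:R.

Definition H_tilde (p : nat) : 'M[R[i]]_(L * p, L) :=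
  \matrix_(i, j) ((val i %/ p)%N == val j)%:R.

Definition E_mr (p : nat) (Kt : signal R -> signal R)
    (K : dsignal R -> dsignal R) (F : ratfun R) (z : R[i]) :
    'M[R[i]]_(L * p, L * p) :=
  (tf (fast_lifted (N := L * p) Kt) z - H_tilde p *m Ktilde K z *m S_row (L * p))
  *m tf (fast_lifted (N := L * p) (io F)) z.

Definition optimal_fir (p : nat) (Kt : signal R -> signal R) (F : ratfun R)
    (M : nat) (a : 'cV[R]_M) : Prop :=
  forall b : 'cV[R]_M,
    (hinf_norm (E_mr p Kt (fir a) F) <= hinf_norm (E_mr p Kt (fir b) F))%E.

End Design.

(* Main.v *)
(* The error system for the sum is the sum of the error systems, so the bound is
   the triangle inequality for the L2 norm, but Minkowski's inequality needs
   measurable outputs. The Markov parameters grow at most geometrically, hence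
   impulse responses are everywhere convergent power series and thus measurable;
   applying Tonelli to positive and negative parts, convolution with them then
   preserves measurability. *)
Require Import Defs.
From mathcomp Require Import all_boot all_order all_algebra.
From mathcomp Require Import all_classical all_reals all_analysis.
From mathcomp Require Import measurable_realfun.
Set Implicit Arguments.
Unset Strict Implicit.
Unset Printing Implicit Defensive.
Import Order.TTheory GRing.Theory Num.Theory.
Import numFieldNormedType.Exports.
Local Open Scope classical_set_scope.
Local Open Scope ring_scope.

(* [Defs.markov] is qualified because the library's Markov inequality has the
   same name. *)
Lemma markov_geometric (R : realType) (G : ratfun R) :
  exists A B : R, 0 <= B /\ forall k, `|Defs.markov G k.+1| <= A * B ^+ k.
Proof.
(* With r k the remainder of X^k numer by d, one step of the long division reads
   X * r k = markov G k.+1 * d + r k.+1. *)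
set d := denom G; set l := lead_coef d; set n := (size d).-1.
have d0 : d != 0 by exact: denom_neq0.
have l0 : 0 < `|l| by rewrite normr_gt0 lead_coef_eq0.
have sd : size d = n.+1 by rewrite prednK// size_poly_gt0.
pose q k := ('X^k * numer G) %/ d; pose r k := ('X^k * numer G) %% d.
have sr k : (size (r k) <= n)%N by rewrite -ltnS -sd ltn_modp.
pose c k := ('X * r k) %/ d.
have E k : 'X^(k.+1) * numer G = ('X * q k + c k) * d + ('X * r k) %% d.
  by rewrite mulrDl -addrA -divp_eq exprS -mulrA (divp_eq ('X^k * numer G) d)
    mulrDr mulrA.
have [Eq Er] : (forall k, q k.+1 = 'X * q k + c k) /\
               (forall k, r k.+1 = ('X * r k) %% d).
  (* Since this remainder is smaller than [d], [E] is a Euclidean division by [d]; uniqueness of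
     quotient and remainder gives both recurrences. *)
  have S k : (size (('X * r k) %% d)%R < size d)%N by rewrite ltn_modp.
  by split=> k; rewrite /q /r E (divp_addl_mul_small, modp_addl_mul_small).
have cC k : c k = (Defs.markov G k.+1)%:P.
  have -> : Defs.markov G k.+1 = (c k)`_0.
    by rewrite /Defs.markov -/d -/(q k.+1) Eq coefD coefXM/= add0r.
  apply: size1_polyC; rewrite size_divp// sd/= leq_subLR addn1.
  have [->|r0] := eqVneq (r k) 0; first by rewrite mulr0 size_poly0.
  by rewrite mulrC size_mulX// ltnS.
(* Comparing coefficients of degree n, where r k.+1 has none, bounds the Markov
   parameter by r k; the other coefficients then bound r k.+1. *)
have Ec k i : ('X * r k)`_i = Defs.markov G k.+1 * d`_i + (r k.+1)`_i.
  by rewrite {1}(divp_eq ('X * r k) d) -/(c k) cC -Er coefD coefCM.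
pose A := \sum_(i < n) `|(r 0)`_i|; pose D := \sum_(i < n.+1) `|d`_i|.
(* If [a] bounds the coefficients of [r k], then [a / |l|] bounds the Markov parameter, so those of
   [r k.+1] are at most [a + (a / |l|) * D = a * B]. *)
pose B := 1 + D / `|l|.
have A0 : 0 <= A by exact: sumr_ge0.
have D0 : 0 <= D by exact: sumr_ge0.
have B0 : 0 <= B by rewrite addr_ge0// divr_ge0// ltW.
have dD i : `|d`_i| <= D.
  have [ni|ni] := ltnP i n.+1; last by rewrite nth_default ?normr0// sd.
  by rewrite /D (bigD1 (Ordinal ni))//= lerDl sumr_ge0.
have Xr k i (a : R) : 0 <= a -> (forall j, `|(r k)`_j| <= a) ->
    `|('X * r k)`_i| <= a.
  by move=> a0 ra; rewrite coefXM; case: ifP => _; rewrite ?normr0.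
have mr k (a : R) : 0 <= a -> (forall j, `|(r k)`_j| <= a) ->
    `|Defs.markov G k.+1| <= a / `|l|.
  move=> a0 ra; rewrite ler_pdivlMr// -normrM.
  have := Ec k n; rewrite (nth_default _ (sr _)) addr0 => <-.
  exact: Xr.
have rA k i : `|(r k)`_i| <= A * B ^+ k.
  elim: k i => [|k IH] i.
    rewrite expr0 mulr1; have [ni|ni] := ltnP i n; last first.
      by rewrite nth_default ?normr0// (leq_trans (sr _)).
    by rewrite /A (bigD1 (Ordinal ni))//= lerDl sumr_ge0.
  have a0 : 0 <= A * B ^+ k by rewrite mulr_ge0// exprn_ge0.
  have -> : (r k.+1)`_i = ('X * r k)`_i - Defs.markov G k.+1 * d`_i.
    by rewrite Ec addrC addKr.
  rewrite exprSr mulrA; move: (A * B ^+ k) a0 IH => a a0 IH.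
  rewrite (le_trans (ler_normB _ _))// /B mulrDr mulr1 lerD//; first exact: Xr.
  by rewrite normrM mulrCA mulrC ler_pM//; exact: mr.
exists (A / `|l|), B; split=> // k.
by rewrite mulrAC mr// mulr_ge0// exprn_ge0.
Qed.

(** The geometric bound dominates the terms by those of [A] times the exponential series at
    [B * |t|]. *)
Lemma is_cvg_impulse_response (R : realType) (G : ratfun R) (t : R) :
  cvgn (series (fun k => Defs.markov G k.+1 * t ^+ k / k`!%:R)).
Proof.
have [A [B [B0 AB]]] := markov_geometric G.
apply: normed_cvg.
apply: (@series_le_cvg _ _ (fun k => A * exp_coeff (B * `|t|) k)) => [n|n|n|].
- exact: normr_ge0.
- rewrite /= mulr_ge0 ?exp_coeff_ge0 ?mulr_ge0//.
  (* The bound at index 0 forces [A] to be nonnegative. *)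
  by have := AB 0; rewrite expr0 mulr1; apply: le_trans.
- rewrite /= /exp_coeff /= !normrM normrX normfV normr_nat exprMn.
  by rewrite !mulrA ler_wpM2r ?invr_ge0 ?ler_wpM2r//.
- by apply: is_cvg_seriesZ; exact: is_cvg_series_exp_coeff.
Qed.

Lemma measurable_impulse_response (R : realType) (G : ratfun R) :
  measurable_fun [set: R] (impulse_response G).
Proof.
pose h n (t : R) := series (fun k => Defs.markov G k.+1 * t ^+ k / k`!%:R) n.
apply: (measurable_fun_cvg (h := h)) => [n|t _].
  rewrite /h /series/=; apply: measurable_sum => k.
  by apply: measurable_funM => //; apply: measurable_funM => //.
exact: is_cvg_impulse_response.
Qed.

Lemma measurable_fun_Rintegral_snd d1 d2 (T1 : measurableType d1)
    (T2 : measurableType d2) (R : realType)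
    (m2 : {sigma_finite_measure set T2 -> \bar R}) (f : T1 * T2 -> R) :
  measurable_fun setT f ->
  measurable_fun setT (fun x => \int[m2]_y f (x, y)).
Proof.
move=> mf; rewrite /Rintegral.
have mF : measurable_fun setT (EFin \o f) by exact/measurable_EFinP.
apply: (measurableT_comp (@fine_measurable R setT measurableT)).
under eq_fun do rewrite integralE.
apply: emeasurable_funB.
- rewrite (_ : (fun _ => _) = fubini_F m2 (EFin \o f)^\+%E).
    by apply: measurable_fun_fubini_tonelli_F => //; exact: measurable_funepos.
  by apply/funext => x; apply: eq_integral => y _; rewrite !funeposE.
- rewrite (_ : (fun _ => _) = fubini_F m2 (EFin \o f)^\-%E).
    by apply: measurable_fun_fubini_tonelli_F => //; exact: measurable_funeneg.
  by apply/funext => x; apply: eq_integral => y _; rewrite !funenegE.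
Qed.

Lemma measurable_io (R : realType) (G : ratfun R) (u : R -> R) :
  measurable_fun setT u -> measurable_fun setT (io G u).
Proof.
move=> mu; rewrite /io; apply: measurable_funD; first exact: measurable_funM.
under eq_fun do rewrite Rintegral_mkcond.
(* The domain [[0, t]] moves with [t]; absorbed into the integrand, it leaves a parameter integral
   of a function jointly measurable on the plane. *)
pose f (x : R * R) : R := if (0 <= x.2) && (x.2 <= x.1) then
  impulse_response G (x.1 - x.2) * u x.2 else 0.
rewrite (_ : (fun t => _) = fun t => \int[lebesgue_measure]_s f (t, s)).
  apply: measurable_fun_Rintegral_snd; apply: measurable_fun_ifT => //.
    by apply: measurable_and; apply: measurable_fun_ler.
  apply: measurable_funM; last exact: measurableT_comp.
  apply: (measurableT_comp (measurable_impulse_response G)).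
  exact: measurable_funB.
apply/funext => t; apply: eq_Rintegral => s _.
by rewrite patchE mem_setE in_itv.
Qed.

(** Membership in L2 says nothing about negative times, so measurability is tracked on the causal
    part alone. *)
Definition causal_measurable {R : realType} (u : R -> R) :=
  measurable_fun setT (causal_part u).

Lemma causal_measurableW (R : realType) (u : R -> R) :
  measurable_fun setT u -> causal_measurable u.
Proof.
move=> mu; apply/(measurable_restrictT u (measurable_itv _)).
exact: measurable_funTS.
Qed.

(** At a time [t >= 0] the output reads the input on [[0, t]] only. The input may thus be replaced
    by its causal part, which is measurable on the whole line. *)
Lemma causal_part_io (R : realType) (G : ratfun R) (u : R -> R) :
  causal_part (io G u) = causal_part (io G (causal_part u)).
Proof.
apply/funext => t; rewrite /causal_part !patchE; case: ifPn => // t0.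
rewrite /io patchE t0; congr (_ + _); apply: eq_Rintegral => s.
rewrite patchE !mem_setE !in_itv/= => /andP[-> _].
by [].
Qed.

Lemma causal_measurable_io (R : realType) (G : ratfun R) (u : R -> R) :
  causal_measurable u -> causal_measurable (io G u).
Proof.
move=> mu; rewrite /causal_measurable causal_part_io.
exact: causal_measurableW (measurable_io G mu).
Qed.

Lemma causal_measurable_delay (R : realType) (l : R) (u : R -> R) : 0 <= l ->
  causal_measurable u -> causal_measurable (delay l u).
Proof.
move=> l0 mu; rewrite /causal_measurable.
(* As [0 <= l], the condition [l <= t] makes both [t] and [t - l] nonnegative, so truncating before
   or after the delay agrees. *)
rewrite (_ : causal_part _ =
    fun t => if l <= t then causal_part u (t - l) else 0).
  apply: measurable_fun_ifT => //; first exact: measurable_fun_ler.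
  by apply: (measurableT_comp mu); exact: measurable_funB.
apply/funext => t; rewrite /causal_part /delay !patchE !mem_setE !in_itv/= !andbT.
rewrite subr_ge0; case: ifPn => [|t0]; first by case: ifP.
by case: ifPn => // lt; rewrite (le_trans l0 lt) in t0.
Qed.

(** By monotonicity each fibre is an interval, and a preimage is a countable union of fibres. *)
Lemma measurable_truncn (R : realType) :
  measurable_fun [set: R] (@Num.truncn R).
Proof.
move=> _ A _; rewrite setTI.
rewrite (_ : _ @^-1` A = \bigcup_(n in A) [set t : R | Num.truncn t = n]).
  apply: bigcup_measurable => n _; apply: is_interval_measurable.
  move=> x y/= xn yn z /andP[xz zy]; apply/eqP; rewrite eqn_leq.
  by apply/andP; split; [rewrite -yn|rewrite -xn]; exact: le_truncn.
apply/seteqP; split=> [t At|t [n An tn]]; first by exists (Num.truncn t).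
by rewrite /preimage /= (tn : Num.truncn t = n).
Qed.

Lemma measurable_hold (R : realType) (tau : R) (x : nat -> R) :
  measurable_fun [set: R] (hold tau x).
Proof.
have mt : measurable_fun [set: R] (fun t : R => t / tau).
  by exact: mulrr_measurable.
(* Every subset of [nat] is measurable, so the held sequence is arbitrary. *)
have mx : measurable_fun [set: nat] x by [].
exact: (measurableT_comp mx (measurableT_comp (@measurable_truncn R) mt)).
Qed.

Lemma causal_measurableB (R : realType) (u v : R -> R) :
  causal_measurable u -> causal_measurable v ->
  causal_measurable (fun t => u t - v t).
Proof.
move=> mu mv; rewrite /causal_measurable.
rewrite (_ : causal_part _ = causal_part u \- causal_part v).
  exact: measurable_funB.
by apply/funext => t; rewrite /causal_part /= !patchE; case: ifP; rewrite ?subr0.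
Qed.

(** Both claims go through one induction, since Minkowski's inequality needs the tail sum to be
    measurable. *)
Lemma L2norm_sum (R : realType) (I : Type) (s : seq I) (u : I -> R -> R) :
  (forall i, causal_measurable (u i)) ->
  causal_measurable (fun t => \sum_(i <- s) u i t) /\
  (L2norm (fun t => (\sum_(i <- s) u i t)%R) <= \sum_(i <- s) L2norm (u i))%E.
Proof.
move=> mu; elim: s => [|i s [ms IH]].
  have E : causal_part (fun t : R => \sum_(i <- [::]) u i t) = cst 0.
    by apply/funext => t; rewrite /causal_part patchE big_nil if_same.
  rewrite /causal_measurable /L2norm E; split=> //.
  by rewrite big_nil Lnorm0.
have E : causal_part (fun t : R => \sum_(j <- i :: s) u j t) =
    causal_part (u i) \+ causal_part (fun t => \sum_(j <- s) u j t).
  apply/funext => t; rewrite /causal_part /= !patchE.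
  by case: ifP => _; rewrite ?big_cons ?addr0.
rewrite /causal_measurable E; split; first exact: measurable_funD (mu i) ms.
rewrite big_cons /L2norm E; apply: le_trans (leeD2l _ IH).
by apply: minkowski_EFin; [exact: mu|exact: ms|rewrite ler1n].
Qed.

Theorem lemma2 (R : realType) (L : nat) (hL : (2 <= L)%N) (h : R) (hh : 0 < h)
    (F : ratfun R) (F_stable : stable_tf F) (F_sproper : strictly_proper_tf F)
    (mu : nat) (hmu : (1 <= mu)%N)
    (G : 'I_mu -> ratfun R)
    (G_stable : forall i, stable_tf (G i)) (G_proper : forall i, proper_tf (G i))
    (m : 'I_mu -> nat)
    (M p : nat) (hM : (1 <= M)%N) (hp : (1 <= p)%N)
    (a : 'I_mu -> 'cV[R]_M)
    (a_opt : forall i, optimal_fir h L p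
       (fun u => delay ((m i)%:R * h) (io (G i) u)) F (a i)) :
  (sd_norm (error_system h L
     (fun u t => (\sum_(i < mu) delay ((m i)%:R * h) (io (G i) u) t)%R)
     (fun x n => (\sum_(i < mu) fir (a i) x n)%R) F)
   <= \sum_(i < mu) sd_norm (error_system h L
        (fun u => delay ((m i)%:R * h) (io (G i) u)) (fir (a i)) F))%E.
Proof.
pose E i := error_system h L
  (fun u => delay ((m i)%:R * h) (io (G i) u)) (fir (a i)) F.
apply: ge_ereal_sup => _ [w [w2 w0] <-].
have mw : causal_measurable w.
  by move: w2; rewrite /in_L2 => /andP[]; rewrite inE.
have mE i : causal_measurable (E i w).
  rewrite /E /error_system; apply: causal_measurableB.
    apply: causal_measurable_delay; first by rewrite mulr_ge0// ltW.
    by do 2 apply: causal_measurable_io.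
  exact: causal_measurableW (measurable_hold _ _).
(* All filters see the same upsampled input and [hold] only picks an index, so the two sums combine
   termwise. *)
rewrite (_ : error_system _ _ _ _ _ _ = fun t => \sum_(i < mu) E i w t).
  2: by apply/funext => t; rewrite /E /error_system sumrB.
apply: (@le_trans _ _ ((\sum_(i < mu) L2norm (E i w)) / L2norm w)%E).
  rewrite lee_wpmul2r ?inve_ge0 ?Lnorm_ge0//.
  exact: (L2norm_sum _ mE).2.
(* Distributivity in the extended reals uses that the norms are nonnegative; each quotient then lies
   below its own supremum, at the same [w]. *)
rewrite ge0_sume_distrl; last by move=> i _; exact: Lnorm_ge0.
by apply: lee_sum => i _; apply: ereal_sup_ubound; exists w.
Qed.
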